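(* Let $p,q\ge 1$ and let $\mathrm{d}\mu$ be a $q\times p$ matrix of measures supported on $\Delta\subseteq\mathbb{R}$ with moment matrix $\mathcal{M}$, such that for every $k\in\mathbb{N}_0$ all leading principal submatrices of the perturbed moment matrices $\mathcal{M}_L^{(k)}=\mathcal{M}(\Lambda^k)^\top$ and $\mathcal{M}_R^{(k)}=\Lambda^k\mathcal{M}$ are nonsingular. For $n\in\mathbb{N}_0$ and $r\in\mathbb{N}$ let $r(n,r)\in\{0,\dots,r-1\}$ denote the remainder of the integer division of $n$ by $r$. Then, for every $k\ge1$ and $n\in\mathbb{N}_0$, the entries of the bidiagonal matrices $L_k$ and $U_k$ (defined in the context) are given in terms of leading coefficients of the Christoffel-perturbed mixed multiple orthogonal polynomials by $$(L_k)_{n+1,n}=\frac{\operatorname{LC}\Bigl(\bigl(A_L^{(k)}\bigr)^{(r(n,p)+1)}_{n}\Bigr)}{\operatorname{LC}\Bigl(\bigl(A_L^{(k-1)}\bigr)^{(r(n+1,p)+1)}_{n+1}\Bigr)},\qquad (U_k)_{n,n+1}=\frac{\operatorname{LC}\Bigl(\bigl(B_R^{(k)}\bigr)^{(r(n,q)+1)}_{n}\Bigr)}{\operatorname{LC}\Bigl(\bigl(B_R^{(k-1)}\bigr)^{(r(n+1,q)+1)}_{n+1}\Bigr)},$$ where $\operatorname{LC}(P)$ denotes the leading coefficient of a polynomial $P$.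
   Context: All matrices denoted by $\mathcal{M},\mathcal{L},\mathcal{U},\Lambda,L_j,U_j$ are semi-infinite, with rows and columns indexed by $\mathbb{N}_0=\{0,1,2,\dots\}$. Moment matrix: $\mathrm{d}\mu=(\mathrm{d}\mu_{b,a})_{1\le b\le q,\,1\le a\le p}$ is a matrix of measures supported on $\Delta\subseteq\mathbb{R}$ with finite moments of all orders. For $r\in\mathbb{N}$, $X_{[r]}(x)=[I_r,\,xI_r,\,x^2I_r,\dots]^\top$ (the semi-infinite block column with $r\times r$ blocks $I_r,xI_r,x^2I_r,\dots$). The moment matrix is $\mathcal{M}=\mathcal{M}(\mu)=\int_\Delta X_{[q]}(x)\,\mathrm{d}\mu(x)\,X_{[p]}^\top(x)$. $\Lambda$ is the shift matrix, $\Lambda_{n,n+1}=1$ and all other entries $0$. Christoffel perturbations: let $\mathfrak{X}_{[r]}(x)$ be the $r\times r$ matrix with ones on the first superdiagonal, $x$ in the lower-left corner (last row, first column), and zeros elsewhere (for $r=1$, $\mathfrak{X}_{[1]}=x$). Put $\mathrm{d}\mu_L^{(k)}=\mathrm{d}\mu\,(\mathfrak{X}_{[p]}^k)^\top$ and $\mathrm{d}\mu_R^{(k)}=\mathfrak{X}_{[q]}^k\,\mathrm{d}\mu$ for $k\in\mathbb{N}_0$. Their moment matrices are $\mathcal{M}_L^{(k)}=\mathcal{M}(\mu_L^{(k)})=\mathcal{M}(\Lambda^k)^\top$ and $\mathcal{M}_R^{(k)}=\mathcal{M}(\mu_R^{(k)})=\Lambda^k\mathcal{M}$. Gauss--Borel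 factorizations: under the nonsingularity assumption, each of these moment matrices factors as (lower triangular)$^{-1}$(upper triangular)$^{-1}$ with nonsingular (i.e. nonzero diagonal) triangular factors. The left normalization takes the lower factor unitriangular, the right normalization takes the upper factor unitriangular; each normalized factorization is unique. $\mathcal{M}_L^{(k)}=(\mathcal{L}_L^{(k)})^{-1}(\mathcal{U}_L^{(k)})^{-1}$ is the left-normalized factorization ($\mathcal{L}_L^{(k)}$ lower unitriangular, $\mathcal{U}_L^{(k)}$ upper triangular), and $\mathcal{M}_R^{(k)}=(\mathcal{L}_R^{(k)})^{-1}(\mathcal{U}_R^{(k)})^{-1}$ is the right-normalized factorization ($\mathcal{U}_R^{(k)}$ upper unitriangular, $\mathcal{L}_R^{(k)}$ lower triangular). For $k=0$ these refer to the unperturbed $\mathcal{M}$. Mixed multiple orthogonal polynomials: after $k$ left Christoffel perturbations the left-normalized polynomials are the entries of the $p\times\infty$ matrix $A_L^{(k)}(x)=X_{[p]}^\top(x)\,\mathcal{U}_L^{(k)}$; the entry in row $a\in\{1,\dots,p\}$ and column $n\in\mathbb{N}_0$ is denoted $(A_L^{(k)})^{(a)}_n$. After $k$ right Christoffel perturbations the right-normalized polynomials are the entries of the $\infty\times q$ matrix $B_R^{(k)}(x)=\mathcal{L}_R^{(k)}X_{[q]}(x)$; the entry in row $n\in\mathbb{N}_0$ and column $b\in\{1,\dots,q\}$ is denoted $(B_R^{(k)})^{(b)}_n$. Matrices $L_k,U_k$ ($k\ge1$): $L_k$ is the lower unitriangular factor in the (unique) factorization of the upper Hessenberg matrix $(\mathcal{U}_L^{(k-1)})^{-1}\Lambda^\top$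 as (lower unitriangular)(upper triangular); it is lower bidiagonal. $U_k$ is the upper unitriangular factor in the (unique) factorization of the lower Hessenberg matrix $\Lambda(\mathcal{L}_R^{(k-1)})^{-1}$ as (lower triangular)(upper unitriangular); it is upper bidiagonal. *)

(* Defs.v *)
From HB Require Import structures.
From mathcomp Require Import all_boot all_order all_algebra.
From mathcomp Require Import all_classical all_reals all_analysis.

Set Implicit Arguments.
Unset Strict Implicit.
Unset Printing Implicit Defensive.

Import Order.TTheory GRing.Theory Num.Theory.
Import numFieldNormedType.Exports.

Local Open Scope classical_set_scope.
Local Open Scope ring_scope.

Notation smx R := (nat -> nat -> R).

Section SemiInfinite.
Variable R : realType.
Implicit Types (A B M L U : smx R).

(* [\sum_(k \in setT)] is the finitely supported sum; every product used below
   has only finitely many nonzero terms in each entry. *)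
Definition smul A B : smx R := fun i j => \sum_(k \in [set: nat]) A i k * B k j.

Definition sid : smx R := fun i j => (i == j)%:R.
Definition strans A : smx R := fun i j => A j i.
Definition shift : smx R := fun i j => (j == i.+1)%:R.
Definition spow A (k : nat) : smx R := iter k (smul A) sid.

(* Two-sided inverse; it is unique for the triangular matrices with nonzero
   diagonal to which it is applied. *)
Definition sinv A : smx R := get [set B | smul A B = sid /\ smul B A = sid].

Definition lower_tri A := forall i j, (i < j)%N -> A i j = 0.
Definition upper_tri A := forall i j, (j < i)%N -> A i j = 0.
Definition unit_diag A := forall i, A i i = 1.
Definition nonzero_diag A := forall i, A i i != 0.

Definition leading_minors_nonsingular M :=
  forall n, (\matrix_(i < n, j < n) M i j) \in unitmx.

(* Pairs [(L, U)] with [M = L^-1 U^-1]. *)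
Definition left_GaussBorel M : smx R * smx R := get [set LU |
  [/\ lower_tri LU.1, unit_diag LU.1, upper_tri LU.2, nonzero_diag LU.2
    & M = smul (sinv LU.1) (sinv LU.2)]].

Definition right_GaussBorel M : smx R * smx R := get [set LU |
  [/\ lower_tri LU.1, nonzero_diag LU.1, upper_tri LU.2, unit_diag LU.2
    & M = smul (sinv LU.1) (sinv LU.2)]].

(* Pairs [(L, U)] with [H = L U]. *)
Definition left_LU (H : smx R) : smx R * smx R := get [set LU |
  [/\ lower_tri LU.1, unit_diag LU.1, upper_tri LU.2 & H = smul LU.1 LU.2]].

Definition right_LU (H : smx R) : smx R * smx R := get [set LU |
  [/\ lower_tri LU.1, upper_tri LU.2, unit_diag LU.2 & H = smul LU.1 LU.2]].

Lemma smul_single A B i j m :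
  (forall k, k != m -> A i k * B k j = 0) -> smul A B i j = A i m * B m j.
Proof.
move=> AB0; rewrite /smul -(@fsbig_widen _ _ _ _ [set m]) ?fsbig_set1//.
by move=> k [_ /eqP km] /=; rewrite AB0.
Qed.

Lemma spow_shiftE k i j : spow shift k i j = (j == i + k)%N%:R.
Proof.
elim: k i j => [|k IH] i j; first by rewrite /spow /sid addn0 eq_sym.
rewrite /spow iterS -/(spow shift k) (@smul_single _ _ _ _ i.+1).
  by rewrite /shift eqxx mul1r IH addSnnS.
by move=> l /negPf li; rewrite /shift li mul0r.
Qed.

End SemiInfinite.

Section ChargeIntegral.
Variable R : realType.
Implicit Types (nu : {charge set (measurableTypeR R) -> \bar R}).
Implicit Types (D : set (measurableTypeR R)) (f : R -> R).

Definition hahn_sig nu :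
  {PN : set (measurableTypeR R) * set (measurableTypeR R) |
    hahn_decomposition nu PN.1 PN.2}.
Proof.
by apply: cid; have [P [N PN]] := Hahn_decomposition nu; exists (P, N).
Qed.

Definition charge_pos nu := jordan_pos (svalP (hahn_sig nu)).
Definition charge_neg nu := jordan_neg (svalP (hahn_sig nu)).

Definition charge_integral nu D f : R :=
  \int[charge_pos nu]_(x in D) f x - \int[charge_neg nu]_(x in D) f x.

Definition supported_on nu D :=
  forall A, measurable A -> A `&` D = set0 -> nu A = 0%E.

Definition finite_moments nu D := forall n : nat,
  (charge_pos nu).-integrable D (fun x : R => (x ^+ n)%:E) /\
  (charge_neg nu).-integrable D (fun x : R => (x ^+ n)%:E).

End ChargeIntegral.

(* A [q x p] matrix of (real, possibly signed) measures on the line: the entries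
   of a perturbed matrix carry powers of [x], so they need not be positive. *)
Notation measure_matrix R q p :=
  ('I_q -> 'I_p -> {charge set (measurableTypeR R) -> \bar R}).

Section MixedMOP.
Variable R : realType.

(* Scalar row [i] of the block column [I_r, x I_r, x^2 I_r, ...]^T. *)
Definition Xrow (r i : nat) : 'rV[{poly R}]_r :=
  \row_b (if nat_of_ord b == (i %% r)%N then 'X^(i %/ r) else 0).

Definition frakX (r : nat) : 'M[{poly R}]_r :=
  \matrix_(i, j) (if nat_of_ord j == i.+1 then 1
                  else if (i.+1 == r) && (nat_of_ord j == 0%N) then 'X else 0).

Lemma Xrow_frakX r i k : (0 < r)%N -> Xrow r i *m frakX r ^+ k = Xrow r (i + k)%N.
Proof.
move=> r_gt0; elim: k i => [|k IH] i; first by rewrite expr0 addn0 [LHS]mulmx1.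
rewrite exprS [X in _ *m X]/(frakX r *m frakX r ^+ k) mulmxA addnS -addSn -IH.
congr (_ *m _); apply/rowP => j; rewrite !mxE.
rewrite (bigD1 (Ordinal (ltn_pmod i r_gt0)))//= big1 ?addr0; last first.
  by move=> b; rewrite -val_eqE/= => /negPf ib; rewrite !mxE ib mul0r.
rewrite !mxE /= eqxx.
have ir := divn_eq i r; have lt_ir := ltn_pmod i r_gt0.
have [jr|jr] := ltnP (i %% r).+1 r.
  have -> : (i.+1 %% r = (i %% r).+1)%N.
    by rewrite {1}ir -addnS modnMDl modn_small.
  have -> : (i.+1 %/ r = i %/ r)%N.
    by rewrite {1}ir -addnS divnMDl// (divn_small jr) addn0.
  rewrite (ltn_eqF jr) andFb; case: ifP => _; first by rewrite mulr1.
  by rewrite mulr0.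
have er : (i %% r).+1 = r by apply/eqP; rewrite eqn_leq lt_ir jr.
have er1 : i.+1 = ((i %/ r).+1 * r)%N by rewrite {1}ir -addnS er mulSnr.
rewrite er eqxx andTb (ltn_eqF (ltn_ord j)) er1 modnMl.
rewrite mulnK//; case: ifP => _; last by rewrite mulr0.
by rewrite exprSr.
Qed.

Variables (q p : nat) (D : set (measurableTypeR R)) (mu : measure_matrix R q p).

(* Moment matrix of the matrix of measures [WL dmu WR], for polynomial matrix
   densities [WL] and [WR]: the integral over [D] of
   [X_[q] WL dmu WR X_[p]^T]. *)
Definition moment_matrix (WL : 'M[{poly R}]_q) (WR : 'M[{poly R}]_p) : smx R :=
  fun i j => \sum_(b < q) \sum_(a < p)
    charge_integral (mu b a) D
      (fun x => ((Xrow q i *m WL) 0 b).[x] * ((WR *m (Xrow p j)^T) a 0).[x]).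

Definition moment0 : smx R := moment_matrix 1%:M 1%:M.
Definition momentL (k : nat) : smx R := moment_matrix 1%:M (frakX p ^+ k)^T.
Definition momentR (k : nat) : smx R := moment_matrix (frakX q ^+ k) 1%:M.

Lemma moment_matrix_row WL WR i j i' j' :
  Xrow q i *m WL = Xrow q i' -> WR *m (Xrow p j)^T = (Xrow p j')^T ->
  moment_matrix WL WR i j = moment0 i' j'.
Proof.
by move=> WLE WRE; rewrite /moment0 /moment_matrix WLE WRE mulmx1 mul1mx.
Qed.

Lemma momentLE k : (0 < p)%N ->
  momentL k = smul moment0 (strans (spow (@shift R) k)).
Proof.
move=> p_gt0; apply/funext => i; apply/funext => j.
rewrite (@smul_single _ _ _ _ _ (j + k)%N) /strans; last first.
  by move=> l /negPf lj; rewrite spow_shiftE lj mulr0.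
rewrite spow_shiftE eqxx mulr1; apply: moment_matrix_row; first by rewrite mulmx1.
by rewrite -trmx_mul Xrow_frakX.
Qed.

Lemma momentRE k : (0 < q)%N ->
  momentR k = smul (spow (@shift R) k) moment0.
Proof.
move=> q_gt0; apply/funext => i; apply/funext => j.
rewrite (@smul_single _ _ _ _ _ (i + k)%N); last first.
  by move=> l /negPf lj; rewrite spow_shiftE lj mul0r.
rewrite spow_shiftE eqxx mul1r; apply: moment_matrix_row; last by rewrite mul1mx.
by rewrite Xrow_frakX.
Qed.

Definition LfacL k : smx R := (left_GaussBorel (momentL k)).1.
Definition UfacL k : smx R := (left_GaussBorel (momentL k)).2.
Definition LfacR k : smx R := (right_GaussBorel (momentR k)).1.
Definition UfacR k : smx R := (right_GaussBorel (momentR k)).2.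

(* With 0-based [a] and [b]: the entries of [X_[p]^T UfacL] and [LfacR X_[q]]. *)
Definition polyA (k : nat) (a : 'I_p) (n : nat) : {poly R} :=
  \sum_(i \in [set: nat]) UfacL k i n *: Xrow p i 0 a.
Definition polyB (k : nat) (b : 'I_q) (n : nat) : {poly R} :=
  \sum_(i \in [set: nat]) LfacR k n i *: Xrow q i 0 b.

(* Only meaningful for [1 <= k]. *)
Definition Lbidiag (k : nat) : smx R :=
  (left_LU (smul (sinv (UfacL k.-1)) (strans (@shift R)))).1.
Definition Ubidiag (k : nat) : smx R :=
  (right_LU (smul (@shift R) (sinv (LfacR k.-1)))).2.

End MixedMOP.

(* The remainder of [n] by [r], as a 0-based row or column index. *)
Definition rem_ord (n r : nat) (r_gt0 : (0 < r)%N) : 'I_r :=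
  Ordinal (ltn_pmod n r_gt0).

(* Main.v *)
(* Adding one column shift, M' = M Lambda^T, to M = L^-1 U^-1 turns
   M' = L'^-1 U'^-1 into U^-1 Lambda^T = (L L'^-1) U'^-1.  By uniqueness of the
   LU factorization L L'^-1 is the bidiagonal factor L_k, and comparing the
   entries (n+1, n) gives 1 / U_(n+1,n+1) = (L_k)_(n+1,n) / U'_(n,n).  The
   diagonal entries of U are the leading coefficients of the polynomials A.
   The statement for B is the transpose of this one. *)
Require Import Defs.
From mathcomp Require Import all_boot all_order all_algebra.
From mathcomp Require Import all_classical all_reals all_analysis.

Set Implicit Arguments.
Unset Strict Implicit.
Unset Printing Implicit Defensive.

Import Order.TTheory GRing.Theory Num.Theory.
Import numFieldNormedType.Exports.
Local Open Scope classical_set_scope.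
Local Open Scope ring_scope.

(** * Products of triangular semi-infinite matrices, and elimination *)

Section TriangularMatrices.
Context {R : realType}.
Implicit Types (A B C H L M T U : smx R).

Lemma fsbigop_ord (V : nmodType) (f : nat -> V) (N : nat) :
  (forall k, (N <= k)%N -> f k = 0) ->
  \sum_(k \in [set: nat]) f k = \sum_(k < N) f k.
Proof.
move=> f0; rewrite -(@fsbig_widen _ _ _ _ `I_N) //; last first.
  by move=> k [_ /negP kN] /=; apply: f0; rewrite leqNgt.
by rewrite fsbig_ord.
Qed.

Lemma smul_ord A B i j N :
  (forall k, (N <= k)%N -> A i k * B k j = 0) ->
  smul A B i j = \sum_(k < N) A i k * B k j.
Proof. exact: fsbigop_ord. Qed.

Lemma smul_lowerE A B i j N : lower_tri A -> (i < N)%N ->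
  smul A B i j = \sum_(k < N) A i k * B k j.
Proof.
by move=> lA iN; apply: smul_ord => k /(leq_trans iN) /lA ->; rewrite mul0r.
Qed.

Lemma strans_smul A B : strans (smul A B) = smul (strans B) (strans A).
Proof.
apply/funext => i; apply/funext => j; rewrite /strans /smul.
by apply: eq_fsbigr => k _; rewrite mulrC.
Qed.

Lemma strans_sid : strans (@sid R) = @sid R.
Proof.
by apply/funext => i; apply/funext => j; rewrite /strans /sid eq_sym.
Qed.

Lemma smul_sid_l A : smul (@sid R) A = A.
Proof.
apply/funext => i; apply/funext => j.
rewrite (@smul_single _ _ _ _ _ i) /sid ?eqxx ?mul1r // => k /negPf ki.
by rewrite eq_sym ki mul0r.
Qed.

Lemma smul_sid_r A : smul A (@sid R) = A.
Proof.
by rewrite -[LHS]/(strans (strans _)) strans_smul strans_sid smul_sid_l.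
Qed.

(** Associativity of [smul] fails for general semi-infinite matrices. With two lower triangular
    factors on the left, every sum in row [i] stops at [i], so only finite sums are exchanged. *)
Lemma smul_lowerA A B C : lower_tri A -> lower_tri B ->
  smul A (smul B C) = smul (smul A B) C.
Proof.
move=> lA lB; apply/funext => i; apply/funext => j.
have AB k : smul A B i k = \sum_(l < i.+1) A i l * B l k by exact: smul_lowerE.
rewrite (@smul_lowerE _ _ _ _ i.+1) // (@smul_ord _ _ _ _ i.+1); last first.
  move=> k ik; rewrite AB big1 ?mul0r // => l _.
  by rewrite lB ?mulr0 // (leq_trans (ltn_ord l)).
under eq_bigr => l _ do rewrite (@smul_lowerE _ _ _ _ i.+1) // big_distrr /=.
rewrite exchange_big /=; apply: eq_bigr => k _.
by rewrite AB big_distrl /=; apply: eq_bigr => l _; rewrite mulrA.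
Qed.

Lemma lower_tri_smul A B : lower_tri A -> lower_tri B -> lower_tri (smul A B).
Proof.
move=> lA lB i j ij; rewrite (@smul_lowerE _ _ _ _ i.+1) // big1 // => k _.
by rewrite lB ?mulr0 // (leq_ltn_trans _ ij) // -ltnS.
Qed.

Lemma smul_lower_diag A B i :
  lower_tri A -> lower_tri B -> smul A B i i = A i i * B i i.
Proof.
move=> lA lB; rewrite (@smul_single _ _ _ _ _ i) // => k.
by rewrite neq_ltn => /orP[/lB ->|/lA ->]; rewrite ?mulr0 ?mul0r.
Qed.

(* Row [n] of [L] is [(- v M_n^-1, 1, 0, ...)], where [M_n] is the leading
   block of size [n] and [v] the part of row [n] of [M] to the left of the
   diagonal. *)
Lemma lower_elimination M : leading_minors_nonsingular M ->
  exists L, [/\ lower_tri L, unit_diag L, upper_tri (smul L M)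
    & nonzero_diag (smul L M)].
Proof.
move=> Mns.
pose Mn n : 'M[R]_n := \matrix_(i < n, j < n) M i j.
pose v n : 'rV[R]_n := \row_j M n j.
pose L : smx R := fun n i => match ltnP i n with
  | LtnNotGeq lt_in => - (v n *m invmx (Mn n)) 0 (Ordinal lt_in)
  | _ => (i == n)%:R end.
have lL : lower_tri L.
  move=> i j ij; rewrite /L; case: ltnP => [ji|_].
    by move: (ltn_trans ij ji); rewrite ltnn.
  by rewrite gtn_eqF.
have uL : unit_diag L.
  move=> i; rewrite /L; case: ltnP => [ii|_]; last by rewrite eqxx.
  by have := ii; rewrite ltnn.
have LE n (i : 'I_n) : L n i = - (v n *m invmx (Mn n)) 0 i.
  rewrite /L; case: ltnP => [ni|]; last by rewrite leqNgt ltn_ord.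
  by congr (- _ _ _); apply: val_inj.
have uLM : upper_tri (smul L M).
  move=> n j jn; rewrite (@smul_lowerE _ _ _ _ n.+1) // big_ord_recr /=.
  rewrite uL mul1r.
  (* Entry [j] of this identity says that the terms [i < n] of the sum add up to [- M n j]. *)
  have /(congr1 (fun w : 'rV_n => w 0 (Ordinal jn))) :
      v n *m invmx (Mn n) *m Mn n = v n by rewrite mulmxKV //; exact: Mns.
  rewrite [in RHS]mxE mxE /= => <-; rewrite -big_split /= big1 // => i _.
  by rewrite LE [Mn n i _]mxE mulNr addNr.
exists L; split=> // n; apply/eqP => LMn0.
(* If the pivot vanished, [w], whose last entry is 1, would be a left null vector of the nonsingular
   block of size [n + 1]. *)
pose w : 'rV[R]_n.+1 := \row_i L n i.
have : w *m Mn n.+1 = 0.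
  apply/rowP => j; rewrite !mxE.
  transitivity (smul L M n j).
    rewrite (@smul_lowerE _ _ _ _ n.+1) //.
    by apply: eq_bigr => i _; rewrite !mxE.
  have : (j <= n)%N by rewrite -ltnS.
  by rewrite leq_eqVlt => /orP[/eqP ->|/uLM].
move/(congr1 (fun x => x *m invmx (Mn n.+1))).
rewrite mulmxK ?mul0mx; last exact: Mns.
move/(congr1 (fun x : 'rV_n.+1 => x 0 ord_max)); rewrite !mxE uL.
by move/eqP; rewrite oner_eq0.
Qed.

(** * Inverses of triangular matrices *)

Lemma lower_left_inverse A : lower_tri A -> nonzero_diag A ->
  exists B, [/\ lower_tri B, nonzero_diag B & smul B A = @sid R].
Proof.
move=> lA nzA.
have [|L [lL uL uT nzT]] := @lower_elimination A.
  move=> n; rewrite unitmxE det_trig; last first.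
    by apply/is_trig_mxP => i j ij; rewrite mxE lA.
  by rewrite unitfE; apply/prodf_neq0 => i _; rewrite mxE.
have lT := lower_tri_smul lL lA.
(* [L A] is both lower and upper triangular, hence diagonal; [B] divides the rows of [L] by that
   diagonal. *)
pose B : smx R := fun i j => (smul L A i i)^-1 * L i j.
have lB : lower_tri B by move=> i j ij; rewrite /B lL // mulr0.
exists B; split => //.
  by move=> i; rewrite /B uL mulr1 invr_neq0.
apply/funext => i; apply/funext => j.
transitivity ((smul L A i i)^-1 * smul L A i j).
  rewrite [LHS](@smul_lowerE _ _ _ _ i.+1) //.
  rewrite [in X in _ * X](@smul_lowerE _ _ _ _ i.+1) // big_distrr /=.
  by apply: eq_bigr => k _; rewrite mulrA.
rewrite /sid; case: (ltngtP i j) => [ij|ij|->].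
- by rewrite (lT _ _ ij) mulr0.
- by rewrite (uT _ _ ij) mulr0.
- by rewrite mulVf.
Qed.

(** The left inverse [B] has a left inverse [C] in turn, and [A = (C B) A = C (B A) = C]. *)
Lemma lower_inverse A : lower_tri A -> nonzero_diag A ->
  exists B, [/\ lower_tri B, nonzero_diag B, smul B A = @sid R
    & smul A B = @sid R].
Proof.
move=> lA nzA.
have [B [lB nzB BA]] := lower_left_inverse lA nzA.
have [C [lC _ CB]] := lower_left_inverse lB nzB.
exists B; split => //.
suff -> : A = C by [].
by rewrite -[A]smul_sid_l -CB -smul_lowerA // BA smul_sid_r.
Qed.

(** [get] picks some two-sided inverse, with no triangularity in its specification. Right inverses
    of [A] are unique, by associativity with lower left factors, so the choice is the lower
    triangular one. *)
Lemma sinv_lowerP A : lower_tri A -> nonzero_diag A ->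
  [/\ lower_tri (sinv A), nonzero_diag (sinv A),
      smul (sinv A) A = @sid R, smul A (sinv A) = @sid R
    & forall B, smul A B = @sid R -> B = sinv A].
Proof.
move=> lA nzA; have [B [lB nzB BA AB]] := lower_inverse lA nzA.
have uniqB C : smul A C = @sid R -> C = B.
  by move=> CI; rewrite -[C]smul_sid_l -BA -smul_lowerA // CI smul_sid_r.
have [|AI _] := @getPex _ [set B : smx R | smul A B = @sid R
                                 /\ smul B A = @sid R].
  by exists B.
by rewrite /sinv (uniqB _ AI); split.
Qed.

Lemma sinv_diag A i : lower_tri A -> nonzero_diag A ->
  sinv A i i = (A i i)^-1.
Proof.
move=> lA nzA; have [lI _ _ AI _] := sinv_lowerP lA nzA.
apply: (mulfI (nzA i)); rewrite divff //.
by rewrite -smul_lower_diag // AI /sid eqxx.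
Qed.

Lemma sinv_unit_diag A :
  lower_tri A -> unit_diag A -> unit_diag (sinv A).
Proof.
move=> lA uA i; rewrite sinv_diag ?uA ?invr1 // => j.
by rewrite uA oner_neq0.
Qed.

Lemma sinvK A : lower_tri A -> nonzero_diag A -> sinv (sinv A) = A.
Proof.
move=> lA nzA; have [lI nzI IA _ _] := sinv_lowerP lA nzA.
by have [_ _ _ _ /(_ _ IA) <-] := sinv_lowerP lI nzI.
Qed.

(** The transpose of the inverse chosen for [strans A] is a right inverse of [A], hence [sinv A].
    Results on upper triangular inverses are transported through this identity. *)
Lemma sinv_strans A : lower_tri A -> nonzero_diag A ->
  sinv (strans A) = strans (sinv A).
Proof.
move=> lA nzA; have [_ _ IA AI uI] := sinv_lowerP lA nzA.
have [|_ IB] := @getPex _ [set B : smx R | smul (strans A) B = @sid R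
                                 /\ smul B (strans A) = @sid R].
  by exists (strans (sinv A)); split; rewrite -strans_smul ?IA ?AI strans_sid.
rewrite -(uI (strans (sinv (strans A)))) //.
by rewrite -[A in smul A]/(strans (strans A)) -strans_smul IB strans_sid.
Qed.

Lemma unit_nonzero_diag A : unit_diag A -> nonzero_diag A.
Proof. by move=> uA i; rewrite uA oner_neq0. Qed.

Lemma sinv_stransK A : upper_tri A -> nonzero_diag A ->
  strans (sinv A) = sinv (strans A).
Proof.
move=> uA nzA; rewrite -[A in LHS]/(strans (strans A)) sinv_strans //.
by move=> i j /uA.
Qed.

Lemma sinv_upperP A : upper_tri A -> nonzero_diag A ->
  [/\ upper_tri (sinv A), nonzero_diag (sinv A), sinv (sinv A) = A
    & forall i, sinv A i i = (A i i)^-1].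
Proof.
move=> uA nzA; have sAE := sinv_stransK uA nzA.
have lAt : lower_tri (strans A) by move=> i j /uA.
have nzAt : nonzero_diag (strans A) by exact: nzA.
have [lI nzI _ _ _] := sinv_lowerP lAt nzAt.
split=> [i j ij|i||i].
- by rewrite -[LHS]/(strans (sinv A) j i) sAE lI.
- by rewrite -[sinv A i i]/(strans (sinv A) i i) sAE.
- by rewrite -[sinv A]/(strans (strans (sinv A))) sAE sinv_strans // sinvK.
- by rewrite -[sinv A i i]/(strans (sinv A) i i) sAE sinv_diag.
Qed.

(** * Gauss-Borel and LU factorizations, and the effect of a column shift *)

Definition is_left_GaussBorel M L U :=
  [/\ lower_tri L, unit_diag L, upper_tri U, nonzero_diag U
    & M = smul (sinv L) (sinv U)].

Definition is_left_LU H L U :=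
  [/\ lower_tri L, unit_diag L, upper_tri U & H = smul L U].

Lemma left_GaussBorel_exists M : leading_minors_nonsingular M ->
  exists L U, is_left_GaussBorel M L U.
Proof.
move=> /lower_elimination[L [lL uL uT nzT]].
have [lI _ IL _ _] := sinv_lowerP lL (unit_nonzero_diag uL).
have [uI nzI IK _] := sinv_upperP uT nzT.
(* Elimination makes [T = L M] upper triangular, so [M = L^-1 T] and the factor [U] is [T^-1]. *)
exists L, (sinv (smul L M)); split => //.
by rewrite IK smul_lowerA // IL smul_sid_l.
Qed.

(** Strong induction on [n]: the earlier rows and columns determine row [n] of the upper factor, by
    the unit diagonal of the lower one, and then column [n] of the lower factor, after division by
    [U2 n n]. *)
Lemma left_LU_unique L1 U1 L2 U2 :
  lower_tri L1 -> unit_diag L1 -> upper_tri U1 ->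
  lower_tri L2 -> unit_diag L2 -> upper_tri U2 -> nonzero_diag U2 ->
  smul L1 U1 = smul L2 U2 -> L1 = L2.
Proof.
move=> lL1 uL1 uU1 lL2 uL2 uU2 nzU2 LU.
suff key n : (forall j, U1 n j = U2 n j) /\ (forall i, L1 i n = L2 i n).
  by apply/funext => i; apply/funext => n; case: (key n).
have upE L U i j : upper_tri U ->
    smul L U i j = \sum_(k < j.+1) L i k * U k j.
  by move=> uU; apply: smul_ord => k /uU ->; rewrite mulr0.
elim/ltn_ind: n => n IH.
have Un j : U1 n j = U2 n j.
  have := congr1 (fun X : smx R => X n j) LU.
  rewrite /= !(@smul_lowerE _ _ _ _ n.+1) // !big_ord_recr /= uL1 uL2 !mul1r.
  under eq_bigr => k _ do
    rewrite (proj1 (IH k (ltn_ord k))) (proj2 (IH k (ltn_ord k))).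
  exact: addrI.
split=> // i.
have := congr1 (fun X : smx R => X i n) LU.
rewrite /= !upE // !big_ord_recr /=.
under eq_bigr => k _ do
  rewrite (proj1 (IH k (ltn_ord k))) (proj2 (IH k (ltn_ord k))).
by move/addrI; rewrite Un; apply: mulIf; exact: nzU2.
Qed.

Lemma smul_strans_shift A i j : smul A (strans (@Defs.shift R)) i j = A i j.+1.
Proof.
rewrite (@smul_single _ _ _ _ _ j.+1) /strans /Defs.shift ?eqxx ?mulr1 //.
by move=> k /negPf ->; rewrite mulr0.
Qed.

Lemma left_shift_LU M M' L U L' U' :
  (forall i j, M' i j = M i j.+1) ->
  is_left_GaussBorel M L U -> is_left_GaussBorel M' L' U' ->
  is_left_LU (smul (sinv U) (strans (@Defs.shift R)))
    (smul L (sinv L')) (sinv U').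
Proof.
move=> MM' [lL uL uU nzU ME] [lL' uL' uU' nzU' ME'].
have [lI _ _ LI _] := sinv_lowerP lL (unit_nonzero_diag uL).
have [lI' _ _ _ _] := sinv_lowerP lL' (unit_nonzero_diag uL').
have [uIU' _ _ _] := sinv_upperP uU' nzU'.
split=> //; first exact: lower_tri_smul.
  by move=> i; rewrite smul_lower_diag // uL sinv_unit_diag // mulr1.
(* Inserting [L L^-1] on the left reduces the claim to [L^-1 (U^-1 Lambda^T) = M'], which is then
   checked entrywise. *)
rewrite -smul_lowerA // -ME' -[LHS]smul_sid_l -LI -smul_lowerA //.
congr smul; apply/funext => i; apply/funext => j; rewrite MM' ME.
rewrite !(@smul_lowerE _ _ _ _ i.+1) //.
by apply: eq_bigr => k _; rewrite smul_strans_shift.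
Qed.

(** [L1] and [U1] are arbitrary because the factors picked by [get] are known only through their
    specification; uniqueness identifies [L1] with [L L'^-1]. *)
Lemma left_LU_subdiag M M' L U L' U' L1 U1 n :
  (forall i j, M' i j = M i j.+1) ->
  is_left_GaussBorel M L U -> is_left_GaussBorel M' L' U' ->
  is_left_LU (smul (sinv U) (strans (@Defs.shift R))) L1 U1 ->
  L1 n.+1 n = U' n n / U n.+1 n.+1.
Proof.
move=> MM' GB GB'; have := left_shift_LU MM' GB GB'.
case: GB => lL uL uU nzU _; case: GB' => lL' uL' uU' nzU' _.
set K := smul L _ => -[lK uK uIU' HE] [lL1 uL1 uU1 HE1].
have [uIU _ _ IUd] := sinv_upperP uU nzU.
have [_ nzIU' _ IUd'] := sinv_upperP uU' nzU'.
have -> : L1 = K.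
  by apply: (left_LU_unique lL1 uL1 uU1 lK uK uIU' nzIU'); rewrite -HE1.
have HK i j : smul K (sinv U') i j = \sum_(k < j.+1) K i k * sinv U' k j.
  by apply: smul_ord => k /uIU' ->; rewrite mulr0.
(* [K U'^-1] is upper Hessenberg and [U'^-1] has a nonzero diagonal, so [K] is
   zero below the subdiagonal. *)
have Kbi j i : (j.+1 < i)%N -> K i j = 0.
  elim/ltn_ind: j i => j IH i ji.
  have : smul K (sinv U') i j = 0.
    by rewrite -HE smul_strans_shift uIU.
  rewrite HK big_ord_recr /= big1 ?add0r; last first.
    by move=> k _; rewrite IH ?mul0r // (leq_ltn_trans _ ji) // ltnW ?ltnS.
  by move/eqP; rewrite mulf_eq0 (negPf (nzIU' j)) orbF => /eqP.
have := congr1 (fun X : smx R => X n.+1 n) HE.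
rewrite /= smul_strans_shift HK big_ord_recr /= big1 ?add0r; last first.
  by move=> k _; rewrite Kbi ?mul0r // ltnS.
by rewrite IUd IUd' => ->; rewrite mulrCA divff ?mulr1.
Qed.

Lemma strans_minors M :
  leading_minors_nonsingular M -> leading_minors_nonsingular (strans M).
Proof.
move=> Mns n.
have -> : \matrix_(i < n, j < n) strans M i j
        = (\matrix_(i < n, j < n) M i j)^T.
  by apply/matrixP => i j; rewrite !mxE.
by rewrite unitmx_tr; exact: Mns.
Qed.

End TriangularMatrices.

(** * Specifications of the factors picked by [get] *)

Section GetFactorizations.
Context {R : realType}.
Implicit Types (H L M U : smx R).

Lemma left_GaussBorelP M : leading_minors_nonsingular M ->
  is_left_GaussBorel M (left_GaussBorel M).1 (left_GaussBorel M).2.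
Proof.
move=> /left_GaussBorel_exists[L [U GB]].
exact: (@getPex _ [set LU : smx R * smx R | is_left_GaussBorel M LU.1 LU.2]
  (ex_intro _ (L, U) GB)).
Qed.

Lemma left_LUP H L U : is_left_LU H L U ->
  is_left_LU H (left_LU H).1 (left_LU H).2.
Proof.
move=> LU.
exact: (@getPex _ [set LU : smx R * smx R | is_left_LU H LU.1 LU.2]
  (ex_intro _ (L, U) LU)).
Qed.

(* Right factorizations of a matrix are encoded as left factorizations of its
   transpose. *)
Lemma right_GaussBorelP M : leading_minors_nonsingular M ->
  is_left_GaussBorel (strans M)
    (strans (right_GaussBorel M).2) (strans (right_GaussBorel M).1).
Proof.
move=> /strans_minors/left_GaussBorel_exists[L [U [lL uL uU nzU ME]]].
have [|lR nzR uR udR MR] := @getPex _ [set LU : smx R * smx R |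
  [/\ lower_tri LU.1, nonzero_diag LU.1, upper_tri LU.2, unit_diag LU.2
    & M = smul (sinv LU.1) (sinv LU.2)]].
  (* Transposing [M^T = L^-1 U^-1] gives [M = (U^T)^-1 (L^T)^-1], where [L^T] is upper
     unitriangular. *)
  exists (strans U, strans L); split => //=.
  - by move=> i j /uU.
  - by move=> i j /lL.
  rewrite -[M]/(strans (strans M)) ME strans_smul sinv_stransK //.
  by rewrite -sinv_strans //; exact: unit_nonzero_diag.
split=> //.
- by move=> i j /uR.
- by move=> i j /lR.
rewrite [in LHS]MR strans_smul -(sinv_strans lR nzR) sinv_stransK //.
exact: unit_nonzero_diag.
Qed.

Lemma right_LUP H L U : is_left_LU (strans H) L U ->
  is_left_LU (strans H) (strans (right_LU H).2) (strans (right_LU H).1).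
Proof.
move=> [lL uL uU HE].
have [|lR uR udR HR] := @getPex _ [set LU : smx R * smx R |
  [/\ lower_tri LU.1, upper_tri LU.2, unit_diag LU.2 & H = smul LU.1 LU.2]].
  exists (strans U, strans L); split => //=.
  - by move=> i j /uU.
  - by move=> i j /lL.
  by rewrite -strans_smul -HE.
split=> //.
- by move=> i j /uR.
- by move=> i j /lR.
by rewrite -strans_smul -HR.
Qed.

End GetFactorizations.

(** * Leading coefficients as diagonal entries *)

Section LeadingCoefficients.
Context {R : realType}.

(** Only indices [i] congruent to [n] modulo [r] contribute, with degree [i %/ r]. Among those up to
    [n], the degree [n %/ r] is reached at [i = n] alone. *)
Lemma lead_coef_Xrow (r n : nat) (r_gt0 : (0 < r)%N) (f : nat -> R) :
  (forall i, (n < i)%N -> f i = 0) -> f n != 0 ->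
  lead_coef (\sum_(i \in [set: nat]) f i *: Xrow R r i 0 (rem_ord n r_gt0))
  = f n.
Proof.
move=> f0 fn0; rewrite (@fsbigop_ord _ _ n.+1); last first.
  by move=> i /f0 ->; rewrite scale0r.
have top : f n *: Xrow R r n 0 (rem_ord n r_gt0) = f n *: 'X^(n %/ r).
  by rewrite mxE /= eqxx.
rewrite big_ord_recr /= top addrC lead_coefDl ?lead_coefZ ?lead_coefXn ?mulr1//.
rewrite size_scale // size_polyXn ltnS.
apply: (leq_trans (size_sum _ _ _)); apply/bigmax_leqP => i _.
rewrite mxE /=; case: eqP => [ni|_]; last by rewrite scaler0 size_poly0.
apply: (leq_trans (size_scale_leq _ _)); rewrite size_polyXn.
have := ltn_ord i; rewrite [X in (_ < X)%N](divn_eq n r) {1}(divn_eq i r) ni.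
by rewrite ltn_add2r ltn_mul2r => /andP[].
Qed.

End LeadingCoefficients.

(** * Successive perturbations as shifts of the moment matrix *)

Section Moments.
Context {R : realType} {p q : nat}.
Variables (Delta : set (measurableTypeR R)) (mu : measure_matrix R q p).

(** Both sides are the unperturbed moment in row [i] and column [j + k + 1]. *)
Lemma momentLS k i j : (0 < p)%N ->
  momentL Delta mu k.+1 i j = momentL Delta mu k i j.+1.
Proof.
move=> p_gt0; have mLE l i' j' :
    momentL Delta mu l i' j' = moment0 Delta mu i' (j' + l)%N.
  by apply: moment_matrix_row; rewrite ?mulmx1 // -trmx_mul Xrow_frakX.
by rewrite !mLE addSnnS.
Qed.

Lemma momentRS k i j : (0 < q)%N ->
  momentR Delta mu k.+1 i j = momentR Delta mu k i.+1 j.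
Proof.
move=> q_gt0; have mRE l i' j' :
    momentR Delta mu l i' j' = moment0 Delta mu (i' + l)%N j'.
  by apply: moment_matrix_row; rewrite ?mul1mx // Xrow_frakX.
by rewrite !mRE addSnnS.
Qed.

End Moments.

Theorem corollary2p4 (R : realType) (p q : nat)
  (p_gt0 : (1 <= p)%N) (q_gt0 : (1 <= q)%N)
  (Delta : set (measurableTypeR R)) (mu : measure_matrix R q p)
  (mDelta : measurable Delta)
  (mu_supp : forall b a, supported_on (mu b a) Delta)
  (mu_moments : forall b a, finite_moments (mu b a) Delta)
  (nonsingL : forall k, leading_minors_nonsingular (momentL Delta mu k))
  (nonsingR : forall k, leading_minors_nonsingular (momentR Delta mu k))
  (k n : nat) (k_ge1 : (1 <= k)%N) :
  Lbidiag Delta mu k n.+1 n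
    = lead_coef (polyA Delta mu k (rem_ord n p_gt0) n)
      / lead_coef (polyA Delta mu k.-1 (rem_ord n.+1 p_gt0) n.+1)
  /\
  Ubidiag Delta mu k n n.+1
    = lead_coef (polyB Delta mu k (rem_ord n q_gt0) n)
      / lead_coef (polyB Delta mu k.-1 (rem_ord n.+1 q_gt0) n.+1).
Proof.
case: k k_ge1 => [//|k _] /=; split.
  have GB l : is_left_GaussBorel (momentL Delta mu l)
      (LfacL Delta mu l) (UfacL Delta mu l).
    exact: left_GaussBorelP.
  have [_ _ uU nzU _] := GB k; have [_ _ uU' nzU' _] := GB k.+1.
  rewrite !lead_coef_Xrow;
    [|by move=> i; apply: uU|exact: nzU|by move=> i; apply: uU'|exact: nzU'].
  have MM' i j := momentLS Delta mu k i j p_gt0.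
  apply: (left_LU_subdiag n MM' (GB k) (GB k.+1)).
  exact: (left_LUP (left_shift_LU MM' (GB k) (GB k.+1))).
(* After transposition the row shift becomes a column shift: [UfacR] transposed plays the role of
   [L], and [LfacR] transposed that of [U]. *)
have GB l : is_left_GaussBorel (strans (momentR Delta mu l))
    (strans (UfacR Delta mu l)) (strans (LfacR Delta mu l)).
  exact: right_GaussBorelP.
have [_ _ lL nzL _] := GB k; have [_ _ lL' nzL' _] := GB k.+1.
rewrite !lead_coef_Xrow;
  [|by move=> i; apply: lL|exact: nzL|by move=> i; apply: lL'|exact: nzL'].
have MM' i j : strans (momentR Delta mu k.+1) i j
             = strans (momentR Delta mu k) i j.+1.
  exact: momentRS.
rewrite -[LHS]/(strans (Ubidiag Delta mu k.+1) n.+1 n).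
apply: (left_LU_subdiag n MM' (GB k) (GB k.+1)).
have LU := left_shift_LU MM' (GB k) (GB k.+1).
(* The upper Hessenberg matrix of the transposed problem is the transpose of the lower Hessenberg
   matrix that defines [Ubidiag]. *)
have HE : smul (sinv (strans (LfacR Delta mu k))) (strans (@Defs.shift R))
        = strans (smul (@Defs.shift R) (sinv (LfacR Delta mu k))).
  by rewrite strans_smul sinv_strans // => i j /lL.
rewrite HE in LU *; exact: (right_LUP LU).
Qed.
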